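(* Consider a 0-1 knapsack instance with capacity $c$ and $n$ items with profits $p_1,\ldots,p_n$ and weights $w_1 \ge w_2 \ge \cdots \ge w_n$ (all parameters strictly positive integers, $\sum_{i=1}^n w_i > c$, and $w_i \le c$ for all $i$). Let $b=\max\{e\in\{1,\ldots,n\} : \sum_{i=e}^n w_i > c\}$, let $\pi_1,\ldots,\pi_n$ be a permutation of $\{1,\ldots,n\}$ such that $\frac{p_{\pi_i}}{w_{\pi_i}}\le\frac{p_{\pi_{i+1}}}{w_{\pi_{i+1}}}$ for all $i\in\{1,\ldots,n-1\}$, and let $f=\min\{e\in\{1,\ldots,n\} : \sum_{i=1}^e w_{\pi_i}\ge c-w_b+1\}$. Then every inclusionwise maximal solution $\mathbf{x}=(x_1,\ldots,x_n)$ satisfies $$\sum_{i=1}^n p_i x_i \ge \sum_{i=1}^{f-1} p_{\pi_i} + \frac{c-w_b+1-\sum_{i=1}^{f-1} w_{\pi_i}}{w_{\pi_f}}\, p_{\pi_f}.$$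
   Context: A solution is a vector $\mathbf{x}\in\{0,1\}^n$. A solution $\mathbf{x}$ is inclusionwise maximal if $\sum_{i=1}^n w_i x_i \le c$ and there is no index $j$ with $x_j=0$ and $w_j+\sum_{i=1}^n w_i x_i \le c$. *)

(* Defs.v *)
From mathcomp Require Import all_boot all_order all_fingroup all_algebra.

Set Implicit Arguments.
Unset Strict Implicit.
Unset Printing Implicit Defensive.

(* Items are indexed by 'I_n, that is from 0 to n - 1: the item numbered i in
   the mathematical text is the one of index i - 1 here. *)

Definition inclusionwise_maximal (n : nat) (w : 'I_n -> nat) (c : nat)
    (x : {ffun 'I_n -> bool}) : Prop :=
  \sum_(i < n) w i * x i <= c /\
  ~ (exists j : 'I_n, x j = false /\ w j + \sum_(i < n) w i * x i <= c).

(* The maximum and the minimum of a set of indices, as relations; each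
   determines its index uniquely. *)
Definition is_max_index (n : nat) (P : 'I_n -> Prop) (b : 'I_n) : Prop :=
  P b /\ forall e : 'I_n, P e -> e <= b.

Definition is_min_index (n : nat) (P : 'I_n -> Prop) (f : 'I_n) : Prop :=
  P f /\ forall e : 'I_n, P e -> f <= e.

(* Main.v *)
(* A maximal solution omits some item j >= b, since the items from b on do not
   fit together; as w_j <= w_b and j cannot be added, the packed weight is at
   least c - w_b + 1. The right-hand side is the value of the greedy solution of
   the fractional knapsack problem that minimises the profit for that weight:
   with r the ratio of the critical item pi_f, each item satisfies
   p_i (x_i - y_i) >= r w_i (x_i - y_i) where y is the indicator of the
   items before pi_f in the order pi, and these inequalities are summed. *)

Require Import Defs.
From mathcomp Require Import all_boot all_order all_fingroup all_algebra.
From mathcomp Require Import lra.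

Set Implicit Arguments.
Unset Strict Implicit.
Unset Printing Implicit Defensive.

Import Order.TTheory GRing.Theory Num.Theory.

Local Open Scope ring_scope.

Lemma ord_succ_homo (d : Order.disp_t) (T : porderType d) (n : nat)
    (g : 'I_n -> T) :
  (forall i j : 'I_n, j = i.+1 :> nat -> (g i <= g j)%O) ->
  forall i j : 'I_n, (i <= j)%N -> (g i <= g j)%O.
Proof.
move=> g_succ i [j lt_jn] /=; elim: j lt_jn => [|j IHj] lt_jn.
  by rewrite leqn0 => /eqP i0; rewrite (_ : i = Ordinal lt_jn) //; apply: val_inj.
rewrite leq_eqVlt => /predU1P[ij|]; last first.
  by rewrite ltnS => /(IHj (ltnW lt_jn))/le_trans; apply; apply: g_succ.
by rewrite (_ : i = Ordinal lt_jn) //; apply: val_inj.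
Qed.

Lemma maximal_weight_ge (n : nat) (w : 'I_n -> nat) (c : nat) (b : 'I_n)
    (x : {ffun 'I_n -> bool}) :
  (forall i j : 'I_n, (i <= j)%N -> (w j <= w i)%N) ->
  (c < \sum_(i < n | (b <= i)%N) w i)%N ->
  inclusionwise_maximal w c x ->
  (c < w b + \sum_(i < n) w i * x i)%N.
Proof.
move=> w_noninc c_lt [x_le x_max].
case: (pickP (fun j : 'I_n => (b <= j)%N && ~~ x j)) => [j /andP[bj xj]|all_x].
  apply: leq_trans (leq_add (w_noninc _ _ bj) (leqnn _)).
  rewrite ltnNge; apply/negP => le_c; apply: x_max.
  by exists j; split; first exact: negbTE.
(* Otherwise [x] packs every item from [b] on, and these alone already weigh more than [c]. *)
move: c_lt; rewrite ltnNge => /negP[]; apply: leq_trans x_le.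
rewrite big_mkcond leq_sum // => i _; case: ifP => // bi.
by move: (all_x i); rewrite bi /= => /negbFE ->; rewrite muln1.
Qed.

(** Weak duality, with the ratio [r] at [f] as the price of one unit of weight. *)
Lemma fractional_knapsack_ge (R : realFieldType) (n : nat)
    (p w x : 'I_n -> R) (f : 'I_n) (C : R) :
  (forall i, 0 <= p i) -> (forall i, 0 < w i) -> (forall i, 0 <= x i <= 1) ->
  (forall i j : 'I_n, (i <= j)%N -> p i / w i <= p j / w j) ->
  C <= \sum_(i < n) w i * x i ->
  \sum_(i < n | (i < f)%N) p i
    + (C - \sum_(i < n | (i < f)%N) w i) / w f * p f
  <= \sum_(i < n) p i * x i.
Proof.
move=> p_ge0 w_gt0 x01 ratio_le C_le; set r := p f / w f.
have r_ge0 : 0 <= r by rewrite divr_ge0 // ltW.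
(* With y the indicator of [i < f], the difference of the two sides is
   [(p i - r * w i) * (x i - y)]: both factors are nonpositive before [f] and nonnegative from [f]
   on. *)
have exchange i : r * (w i * x i - (if (i < f)%N then w i else 0)) <=
                  p i * x i - (if (i < f)%N then p i else 0).
  have /andP[x_ge0 x_le1] := x01 i.
  case: ltnP => [lt_if|le_fi].
    have : p i <= r * w i by rewrite -ler_pdivrMr // ratio_le // ltnW.
    by nra.
  have : r * w i <= p i by rewrite -ler_pdivlMr // ratio_le.
  by nra.
(* Isolating the fractional term leaves [r] times the weight missing from y on the left, ready for
   the sum of the exchange inequalities. *)
rewrite addrC -lerBrDr mulrAC -mulrA -/r mulrC.
rewrite [X in C - X]big_mkcond [X in _ <= _ - X]big_mkcond /= -sumrB.
apply: le_trans (ler_sum _ (fun i _ => exchange i)).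
by rewrite -mulr_sumr sumrB ler_wpM2l // lerD2r.
Qed.

Theorem theorem2 (n : nat) (p w : 'I_n -> nat) (c : nat)
  (c_gt0 : (0 < c)%N)
  (p_gt0 : forall i : 'I_n, (0 < p i)%N)
  (w_gt0 : forall i : 'I_n, (0 < w i)%N)
  (w_noninc : forall i j : 'I_n, (i <= j)%N -> (w j <= w i)%N)
  (w_sum : (c < \sum_(i < n) w i)%N)
  (w_le_c : forall i : 'I_n, (w i <= c)%N)
  (b : 'I_n)
  (b_max : is_max_index
     (fun e : 'I_n => (c < \sum_(i < n | (e <= i)%N) w i)%N) b)
  (pi : 'S_n)
  (pi_sorted : forall i j : 'I_n, j = i.+1 :> nat ->
     (p (pi i))%:R / (w (pi i))%:R <= (p (pi j))%:R / (w (pi j))%:R :> rat)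
  (f : 'I_n)
  (f_min : is_min_index
     (fun e : 'I_n =>
        (c - w b + 1 <= \sum_(i < n | (i <= e)%N) w (pi i))%N) f)
  (x : {ffun 'I_n -> bool})
  (x_max : inclusionwise_maximal w c x) :
  \sum_(i < n | (i < f)%N) (p (pi i))%:R
    + (c%:R - (w b)%:R + 1 - \sum_(i < n | (i < f)%N) (w (pi i))%:R)
        / (w (pi f))%:R * (p (pi f))%:R
  <= \sum_(i < n) (p i)%:R * (x i)%:R :> rat.
Proof.
have weight_ge := maximal_weight_ge w_noninc (proj1 b_max) x_max.
(* Renumbering the items along [pi] makes index order the order of ratios. *)
rewrite [leRHS](reindex_inj (@perm_inj _ pi)) /=.
apply: (@fractional_knapsack_ge _ _ (fun i => (p (pi i))%:R)
  (fun i => (w (pi i))%:R) (fun i => (x (pi i))%:R)) => [i|i|i||].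
- exact: ler0n.
- by rewrite ltr0n.
- by rewrite ler0n lern1 leq_b1.
- exact: (ord_succ_homo pi_sorted).
rewrite (eq_bigr _ (fun i _ => esym (natrM _ _ _))) -natr_sum.
move: weight_ge; rewrite (reindex_inj (@perm_inj _ pi)) /= => weight_ge.
(* The [+ 1] comes from integrality: the strict bound in [weight_ge] is a bound on [c.+1]. *)
by rewrite addrAC lerBlDl natr1 -natrD ler_nat.
Qed.
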